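(* Let $\zeta \in \mathbb{C}$ with $|\zeta| = 1$ and let $\varphi : \mathbb{D} \to \mathbb{D}$ be $\varphi(z) = \zeta z$. Then the Berezin range $B(C_\varphi)$ of the composition operator $C_\varphi$ acting on $H^2$ is convex if and only if $\zeta = 1$ or $\zeta = -1$.
   Context: $\mathbb{D}$ is the open unit disk in $\mathbb{C}$. $H^2$ is the Hardy space of holomorphic functions $f(z) = \sum_{n\ge 0} a_n z^n$ on $\mathbb{D}$ with $\sum_{n \ge 0} |a_n|^2 < \infty$, with inner product $\langle \sum a_n z^n, \sum b_n z^n\rangle = \sum_{n\ge 0} a_n \overline{b_n}$. Its reproducing kernel at $w \in \mathbb{D}$ (the element $k_w \in H^2$ with $\langle f, k_w \rangle = f(w)$ for all $f \in H^2$) is $k_w(z) = \frac{1}{1 - \overline{w} z}$, and $\hat{k}_w = k_w/\|k_w\|$ is the normalized reproducing kernel. For a bounded linear operator $T$ on $H^2$, the Berezin range is $B(T) = \{\langle T\hat{k}_z, \hat{k}_z\rangle : z \in \mathbb{D}\} \subseteq \mathbb{C}$. The composition operator with symbol $\varphi : \mathbb{D} \to \mathbb{D}$ is $C_\varphi f = f\circ\varphi$. *)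

(* Defs.v *)
From Stdlib Require Import Reals Lra Lia Psatz ProofIrrelevance ClassicalEpsilon
  FunctionalExtensionality.
From Coquelicot Require Import Coquelicot.

Set Implicit Arguments.
Unset Strict Implicit.

Open Scope R_scope.

Record disk : Type := Disk { disk_val :> C; disk_lt1 : Cmod disk_val < 1 }.

Definition is_taylor (a : nat -> C) (f : disk -> C) : Prop :=
  forall z : disk, @is_pseries C_AbsRing C_NormedModule a (disk_val z) (f z).

Definition square_summable (a : nat -> C) : Prop :=
  ex_series (fun n => Cmod (a n) ^ 2).

Definition in_hardy (f : disk -> C) : Prop :=
  exists a : nat -> C, square_summable a /\ is_taylor a f.

Record hardy : Type := Hardy { hardy_fun :> disk -> C;
                               hardyP : in_hardy hardy_fun }.

(* Unique by [taylor_unique] below. *)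
Definition coef (f : hardy) : nat -> C :=
  proj1_sig (constructive_indefinite_description _ (hardyP f)).

(* Coquelicot's [Series] is real-valued; complex series are summed
   componentwise. *)
Definition CSeries (a : nat -> C) : C :=
  (Series (fun n => Re (a n)), Series (fun n => Im (a n))).

Definition inner (f g : hardy) : C :=
  CSeries (fun n => (coef f n * Cconj (coef g n))%C).

Definition hnorm (f : hardy) : R := sqrt (Re (inner f f)).

Lemma coefP (f : hardy) : square_summable (coef f) /\ is_taylor (coef f) f.
Proof.
  unfold coef; destruct (constructive_indefinite_description _ (hardyP f)); auto.
Qed.

Lemma hardy_eq (f g : hardy) : (forall z, f z = g z) -> f = g.
Proof.
  destruct f as [f Hf], g as [g Hg]; simpl; intros E.
  assert (E' : f = g) by (apply functional_extensionality; exact E).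
  subst g; f_equal; apply proof_irrelevance.
Qed.

Lemma sum_n_C (a : nat -> C) n :
  @sum_n C_AbelianMonoid a n
  = (sum_n (fun k => Re (a k)) n, sum_n (fun k => Im (a k)) n).
Proof.
  induction n as [|n IH].
  - rewrite !sum_O; destruct (a O); reflexivity.
  - rewrite !sum_Sn, IH; reflexivity.
Qed.

Lemma is_series_C (a : nat -> C) (l : C) :
  @is_series C_AbsRing C_NormedModule a l <->
  is_series (fun n => Re (a n)) (Re l) /\ is_series (fun n => Im (a n)) (Im l).
Proof.
  unfold is_series; split.
  - intros H; split.
    + apply filterlim_ext with (fun n => Re (@sum_n C_AbelianMonoid a n)).
      { intros n; rewrite sum_n_C; reflexivity. }
      intros P [e He]; apply (H (fun c : C => P (Re c))).
      exists e; intros y Hy; apply He; exact (proj1 Hy).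
    + apply filterlim_ext with (fun n => Im (@sum_n C_AbelianMonoid a n)).
      { intros n; rewrite sum_n_C; reflexivity. }
      intros P [e He]; apply (H (fun c : C => P (Im c))).
      exists e; intros y Hy; apply He; exact (proj2 Hy).
  - intros [H1 H2] P [e He].
    destruct (H1 (ball (Re l) e) (locally_ball _ _)) as [N1 HN1].
    destruct (H2 (ball (Im l) e) (locally_ball _ _)) as [N2 HN2].
    exists (max N1 N2); intros n Hn; apply He.
    change (ball l e (@sum_n C_AbelianMonoid a n)).
    rewrite sum_n_C; split; [apply HN1 | apply HN2]; lia.
Qed.

Lemma CSeries_unique (a : nat -> C) (l : C) :
  @is_series C_AbsRing C_NormedModule a l -> CSeries a = l.
Proof.
  intros [H1 H2]%is_series_C; unfold CSeries.
  rewrite (is_series_unique _ _ H1), (is_series_unique _ _ H2).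
  destruct l; reflexivity.
Qed.

Lemma pow_n_C (z : C) n : @pow_n C_Ring z n = (z ^ n)%C.
Proof. induction n as [|n IH]; simpl; [|rewrite IH]; reflexivity. Qed.

Lemma is_taylor_series (a : nat -> C) (f : disk -> C) (z : disk) :
  is_taylor a f ->
  @is_series C_AbsRing C_NormedModule (fun n => a n * z ^ n)%C (f z).
Proof.
  intros H; generalize (H z); apply is_series_ext.
  intros n; change (@pow_n C_Ring (disk_val z) n * a n = a n * z ^ n)%C.
  rewrite pow_n_C; apply Cmult_comm.
Qed.

Lemma series_is_taylor (a : nat -> C) (f : disk -> C) :
  (forall z : disk,
     @is_series C_AbsRing C_NormedModule (fun n => a n * z ^ n)%C (f z)) ->
  is_taylor a f.
Proof.
  intros H z; generalize (H z); apply is_series_ext.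
  intros n; change (a n * z ^ n = @pow_n C_Ring (disk_val z) n * a n)%C.
  rewrite Cmult_comm; f_equal; symmetry; apply pow_n_C.
Qed.

Lemma CV_radius_comp (a : nat -> R) (b : nat -> C) :
  square_summable b -> (forall n, Rabs (a n) <= Cmod (b n)) ->
  Rbar_lt 0 (CV_radius a).
Proof.
  intros Hb Hab.
  apply Rbar_lt_le_trans with (Finite 1); [simpl; lra|].
  apply CV_radius_bounded.
  destruct (ex_series_lim_0 _ Hb (ball 0 (mkposreal 1 Rlt_0_1)) (locally_ball _ _))
    as [N HN].
  assert (HN' : forall n, (N <= n)%nat -> Cmod (b n) <= 1).
  { intros n Hn; specialize (HN n Hn).
    unfold ball in HN; simpl in HN; unfold AbsRing_ball, abs, minus, plus, opp in HN;
      simpl in HN.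
    pose proof (Cmod_ge_0 (b n)) as H0.
    apply Rabs_def2 in HN; nra. }
  assert (HF : forall m, exists M, forall n, (n < m)%nat -> Cmod (b n) <= M).
  { induction m as [|m [M HM]]; [exists 0; lia|].
    exists (Rmax M (Cmod (b m))); intros n Hn.
    destruct (Nat.eq_dec n m) as [->|Hnm]; [apply Rmax_r|].
    eapply Rle_trans; [apply HM; lia | apply Rmax_l]. }
  destruct (HF N) as [M HM].
  exists (Rmax M 1); intros n; rewrite pow1, Rmult_1_r.
  eapply Rle_trans; [apply Hab|].
  destruct (Nat.lt_ge_cases n N) as [h|h].
  - eapply Rle_trans; [apply HM, h | apply Rmax_l].
  - eapply Rle_trans; [apply HN', h | apply Rmax_r].
Qed.

Lemma Cpow_RtoC (x : R) n : (RtoC x ^ n)%C = RtoC (x ^ n).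
Proof.
  induction n as [|n IH]; simpl; [reflexivity|].
  rewrite IH, RtoC_mult; reflexivity.
Qed.

Lemma taylor_unique (a b : nat -> C) (f : disk -> C) :
  square_summable a -> is_taylor a f ->
  square_summable b -> is_taylor b f -> forall n, a n = b n.
Proof.
  intros Ha Taf Hb Tbf n.
  assert (Hx : forall x, ball 0 (mkposreal 1 Rlt_0_1) x -> Cmod (RtoC x) < 1).
  { intros x Hx; rewrite Cmod_R.
    unfold ball in Hx; simpl in Hx; unfold AbsRing_ball, abs, minus, plus, opp in Hx;
      simpl in Hx.
    replace (x + - 0) with x in Hx by lra; exact Hx. }
  assert (im_le : forall c : C, Rabs (Im c) <= Cmod c).
  { intros c; eapply Rle_trans; [apply Rmax_r | apply (Rmax_Cmod c)]. }
  assert (K : forall c x, is_taylor c f -> forall hx : Cmod (RtoC x) < 1,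
      PSeries (fun n => Re (c n)) x = Re (f (Disk hx)) /\
      PSeries (fun n => Im (c n)) x = Im (f (Disk hx))).
  { intros c x Tc hx.
    destruct (proj1 (is_series_C _ _) (is_taylor_series (z := Disk hx) Tc)) as [H1 H2].
    split; apply is_series_unique.
    - revert H1; apply is_series_ext; intros k; simpl.
      rewrite Cpow_RtoC; unfold Re; simpl; ring.
    - revert H2; apply is_series_ext; intros k; simpl.
      rewrite Cpow_RtoC; unfold Im; simpl; ring. }
  assert (R1 : Re (a n) = Re (b n)).
  { apply (PSeries_ext_recip (fun n => Re (a n)) (fun n => Re (b n))).
    - apply (CV_radius_comp Ha); intros; apply re_le_Cmod.
    - apply (CV_radius_comp Hb); intros; apply re_le_Cmod.
    - exists (mkposreal 1 Rlt_0_1); intros x hx; apply Hx in hx.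
      rewrite (proj1 (K a x Taf hx)), (proj1 (K b x Tbf hx)); reflexivity. }
  assert (R2 : Im (a n) = Im (b n)).
  { apply (PSeries_ext_recip (fun n => Im (a n)) (fun n => Im (b n))).
    - apply (CV_radius_comp Ha); intros; apply im_le.
    - apply (CV_radius_comp Hb); intros; apply im_le.
    - exists (mkposreal 1 Rlt_0_1); intros x hx; apply Hx in hx.
      rewrite (proj2 (K a x Taf hx)), (proj2 (K b x Tbf hx)); reflexivity. }
  destruct (a n), (b n); unfold Re, Im in *; simpl in *; congruence.
Qed.

Lemma coef_unique (f : hardy) (a : nat -> C) :
  square_summable a -> is_taylor a f -> forall n, coef f n = a n.
Proof.
  intros Ha Ta; destruct (coefP f) as [Hc Tc]; exact (taylor_unique Hc Tc Ha Ta).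
Qed.

Lemma inner_is_series (f g : hardy) :
  @is_series C_AbsRing C_NormedModule
    (fun n => coef f n * Cconj (coef g n))%C (inner f g).
Proof.
  assert (E : @ex_series C_AbsRing C_CompleteNormedModule
                (fun n => coef f n * Cconj (coef g n))%C).
  { apply ex_series_le with
      (fun n => Cmod (coef f n) ^ 2 + Cmod (coef g n) ^ 2).
    - intros n; change (Cmod (coef f n * Cconj (coef g n))
                          <= Cmod (coef f n) ^ 2 + Cmod (coef g n) ^ 2).
      rewrite Cmod_mult, Cmod_conj.
      pose proof (Cmod_ge_0 (coef f n)); pose proof (Cmod_ge_0 (coef g n)); nra.
    - apply (ex_series_plus (fun n => Cmod (coef f n) ^ 2)); apply coefP. }
  destruct E as [l Hl]; unfold inner.
  rewrite (CSeries_unique Hl); exact Hl.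
Qed.

Lemma in_hardy_scal (c : C) (f : disk -> C) :
  in_hardy f -> in_hardy (fun z => c * f z)%C.
Proof.
  intros [a [Ha Ta]]; exists (fun n => c * a n)%C; split.
  - apply ex_series_ext with (fun n => scal (Cmod c ^ 2) (Cmod (a n) ^ 2)).
    + intros n; rewrite Cmod_mult; unfold scal; simpl; unfold mult; simpl; ring.
    + destruct Ha as [l Hl]; exists (scal (Cmod c ^ 2) l).
      exact (is_series_scal (V := R_NormedModule) (Cmod c ^ 2) _ _ Hl).
  - apply series_is_taylor; intros z.
    generalize (is_series_scal (V := C_NormedModule) c _ _ (is_taylor_series (z := z) Ta)).
    apply is_series_ext; intros n; apply Cmult_assoc.
Qed.

Definition hscal (c : C) (f : hardy) : hardy :=
  Hardy (in_hardy_scal c (hardyP f)).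

Lemma is_series_Cgeom (q : C) :
  Cmod q < 1 ->
  @is_series C_AbsRing C_NormedModule (fun n => q ^ n)%C (/ (1 - q))%C.
Proof.
  intros Hq.
  assert (Hq1 : (1 - q)%C <> 0%C).
  { intros E; assert (q = 1%C) by (rewrite <- (Cplus_0_l q), <- E; ring).
    subst q; rewrite Cmod_1 in Hq; lra. }
  destruct (ex_series_le (V := C_CompleteNormedModule)
              (fun n => q ^ n)%C (fun n => Cmod q ^ n)) as [l Hl].
  { intros n; change (Cmod (q ^ n) <= Cmod q ^ n).
    rewrite Cmod_pow; apply Rle_refl. }
  { apply ex_series_geom; rewrite Rabs_pos_eq; [exact Hq | apply Cmod_ge_0]. }
  assert (Hs : @is_series C_AbsRing C_NormedModule (fun n => q ^ S n)%C (q * l)%C).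
  { generalize (is_series_scal (V := C_NormedModule) q _ _ Hl).
    apply is_series_ext; intros n; reflexivity. }
  assert (Hd : @is_series C_AbsRing C_NormedModule (fun n => q ^ n)%C (q * l + 1)%C).
  { apply is_series_decr_1.
    replace (plus _ _) with (q * l)%C; [exact Hs|].
    change (q * l = q * l + 1 + - (1))%C; ring. }
  assert (E : l = (q * l + 1)%C).
  { transitivity (CSeries (fun n => q ^ n)%C);
      [symmetry|]; apply CSeries_unique; [exact Hl | exact Hd]. }
  replace (/ (1 - q))%C with l; [exact Hl|].
  assert (E2 : ((1 - q) * l = 1)%C).
  { transitivity (l - q * l)%C; [ring | rewrite E at 1; ring]. }
  transitivity (/ (1 - q) * ((1 - q) * l))%C.
  - rewrite Cmult_assoc, Cinv_l, Cmult_1_l; auto.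
  - rewrite E2; apply Cmult_1_r.
Qed.

Definition kernel_fun (w z : disk) : C := (/ (1 - Cconj w * z))%C.

Lemma kernel_coef (w : disk) :
  square_summable (fun n => Cconj w ^ n)%C /\
  is_taylor (fun n => Cconj w ^ n)%C (kernel_fun w).
Proof.
  pose proof (Cmod_ge_0 w) as H0; pose proof (disk_lt1 w) as H1.
  split.
  - apply ex_series_ext with (fun n => (Cmod w ^ 2) ^ n).
    + intros n; rewrite Cmod_pow, Cmod_conj, <- !pow_mult; f_equal; lia.
    + apply ex_series_geom; rewrite Rabs_pos_eq; nra.
  - apply series_is_taylor; intros z.
    pose proof (Cmod_ge_0 z) as H2; pose proof (disk_lt1 z) as H3.
    assert (Hq : Cmod (Cconj w * z) < 1) by (rewrite Cmod_mult, Cmod_conj; nra).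
    generalize (is_series_Cgeom Hq); apply is_series_ext.
    intros n; apply Cpow_mult_l.
Qed.

Lemma kernel_in_hardy (w : disk) : in_hardy (kernel_fun w).
Proof. exists (fun n => Cconj w ^ n)%C; apply kernel_coef. Qed.

Definition kernel (w : disk) : hardy := Hardy (kernel_in_hardy w).

Lemma kernel_reproducing (f : hardy) (w : disk) : inner f (kernel w) = f w.
Proof.
  unfold inner; apply CSeries_unique.
  destruct (coefP f) as [_ T].
  generalize (is_taylor_series (z := w) T); apply is_series_ext; intros n.
  destruct (kernel_coef w) as [K1 K2].
  rewrite (coef_unique (f := kernel w) K1 K2), <- Cpow_conj, Cconj_conj.
  reflexivity.
Qed.

Definition normalized_kernel (w : disk) : hardy :=
  hscal (/ RtoC (hnorm (kernel w)))%C (kernel w).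

Definition berezin_range (T : hardy -> hardy) (c : C) : Prop :=
  exists z : disk, c = inner (T (normalized_kernel z)) (normalized_kernel z).

Definition convex_subset (S : C -> Prop) : Prop :=
  forall (x y : C) (t : R), S x -> S y -> 0 <= t <= 1 ->
    S (RtoC (1 - t) * x + RtoC t * y)%C.

Definition preserves_hardy (phi : disk -> disk) : Prop :=
  forall f : disk -> C, in_hardy f -> in_hardy (fun z => f (phi z)).

(* The proof that composition with [phi] maps the Hardy space to itself is an
   argument, so that the result is a genuine map [hardy -> hardy]. *)
Definition composition_operator (phi : disk -> disk)
    (hphi : preserves_hardy phi) (f : hardy) : hardy :=
  Hardy (hphi f (hardyP f)).

Arguments composition_operator : clear implicits.

Lemma rotation_lt1 (zeta : C) (z : disk) :
  Cmod zeta = 1 -> Cmod (zeta * z) < 1.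
Proof. intros H; rewrite Cmod_mult, H, Rmult_1_l; apply disk_lt1. Qed.

Definition rotation (zeta : C) (hzeta : Cmod zeta = 1) (z : disk) : disk :=
  Disk (rotation_lt1 z hzeta).

Arguments rotation : clear implicits.

Lemma rotation_preserves_hardy (zeta : C) (hzeta : Cmod zeta = 1) :
  preserves_hardy (rotation zeta hzeta).
Proof.
  intros f [a [Ha Ta]]; exists (fun n => a n * zeta ^ n)%C; split.
  - generalize Ha; apply ex_series_ext; intros n.
    rewrite Cmod_mult, Cmod_pow, hzeta, pow1, Rmult_1_r; reflexivity.
  - apply series_is_taylor; intros z.
    generalize (is_taylor_series (z := rotation zeta hzeta z) Ta); apply is_series_ext.
    intros n; change (a n * (zeta * z) ^ n = a n * zeta ^ n * z ^ n)%C.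
    rewrite Cpow_mult_l; ring.
Qed.

(* Main.v *)
Require Import Defs.
From Stdlib Require Import Reals.
From Coquelicot Require Import Coquelicot.
From Stdlib Require Import Lra.
Open Scope R_scope.

(** By the reproducing property the Berezin transform of [C_phi] at [z] is
    [k_z (phi z) / k_z z].  For a rotation both kernel values depend on [z]
    only through [r = |z|^2], so the Berezin range is the curve
    [(1 - r) / (1 - zeta r)] with [0 <= r < 1] ([berezin_range_rotation]).

    For [zeta = 1] this curve is the point [1]; for [zeta = -1] it is the
    interval [(0, 1]].  Conversely, if the range is convex it contains the
    midpoint of the values at [r = 0] and [r = 1/2].  Equating that midpoint with
    the value at some real [r] and clearing denominators gives
    [(zeta - 1) (1 + r (zeta - 4)) = 0].  The second factor can vanish only when
    [zeta] is real, so [zeta], being unimodular, is [1] or [-1]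
    ([midpoint_on_curve]).  Geometrically, for the other [zeta] the curve is an
    arc of a genuine circle, and its chords leave it. *)

Lemma inner_hscal_r (f g : hardy) (c : C) :
  inner f (hscal c g) = (Cconj c * inner f g)%C.
Proof.
  apply CSeries_unique.
  destruct (coefP g) as [Hg Tg].
  assert (E : forall n, coef (hscal c g) n = (c * coef g n)%C).
  { apply coef_unique.
    - apply ex_series_ext with (fun n => scal (Cmod c ^ 2) (Cmod (coef g n) ^ 2)).
      + intros n; rewrite Cmod_mult; unfold scal; simpl; unfold mult; simpl; ring.
      + destruct Hg as [l Hl]; exists (scal (Cmod c ^ 2) l).
        exact (is_series_scal (V := R_NormedModule) (Cmod c ^ 2) _ _ Hl).
    - apply series_is_taylor; intros z.
      generalize (is_series_scal (V := C_NormedModule) c _ _ (is_taylor_series (z := z) Tg)).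
      apply is_series_ext; intros n; apply Cmult_assoc. }
  generalize (is_series_scal (V := C_NormedModule) (Cconj c) _ _ (@inner_is_series f g)).
  apply is_series_ext; intros n; rewrite E, Cmult_conj.
  change (Cconj c * (coef f n * Cconj (coef g n))
          = coef f n * (Cconj c * Cconj (coef g n)))%C; ring.
Qed.

Lemma Cconj_mult_self (z : C) : (Cconj z * z)%C = RtoC (Cmod z ^ 2).
Proof. rewrite Cmod2_conj; apply Cmult_comm. Qed.

Lemma hnorm_kernel_sqr (z : disk) : hnorm (kernel z) ^ 2 = / (1 - Cmod z ^ 2).
Proof.
  pose proof (Cmod_ge_0 z) as H0; pose proof (disk_lt1 z) as H1.
  unfold hnorm; rewrite kernel_reproducing; simpl hardy_fun.
  unfold kernel_fun; rewrite Cconj_mult_self, <- RtoC_minus, <- RtoC_inv by nra.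
  apply pow2_sqrt; left; apply Rinv_0_lt_compat; simpl; nra.
Qed.

(** The normalizing factor comes out of both slots, so it contributes
    [1 / ||k_z||^2]; what remains is [inner (k_z o phi) k_z], which the reproducing
    property evaluates to [k_z (phi z)]. *)
Lemma berezin_composition (phi : disk -> disk) (hphi : preserves_hardy phi)
    (z : disk) :
  inner (composition_operator phi hphi (normalized_kernel z)) (normalized_kernel z)
  = (RtoC (1 - Cmod z ^ 2) / (1 - Cconj z * phi z))%C.
Proof.
  pose proof (Cmod_ge_0 z) as H0; pose proof (disk_lt1 z) as H1.
  pose proof (hnorm_kernel_sqr z) as Hn.
  assert (Hn0 : hnorm (kernel z) <> 0).
  { intros E; rewrite E in Hn; symmetry in Hn; revert Hn.
    rewrite pow_i by auto with arith; apply Rinv_neq_0_compat; nra. }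
  unfold normalized_kernel at 2; rewrite inner_hscal_r, kernel_reproducing.
  simpl hardy_fun; unfold kernel_fun.
  rewrite <- RtoC_inv by exact Hn0.
  replace (Cconj (RtoC (/ hnorm (kernel z)))) with (RtoC (/ hnorm (kernel z)))
    by (unfold Cconj, RtoC; simpl; rewrite Ropp_0; reflexivity).
  rewrite Cmult_assoc, <- RtoC_mult; unfold Cdiv; f_equal; f_equal.
  rewrite <- (Rinv_inv (1 - Cmod z ^ 2)), <- Hn; field; exact Hn0.
Qed.

Lemma one_minus_rotation_neq0 (zeta : C) (r : R) :
  Cmod zeta = 1 -> 0 <= r < 1 -> (1 - zeta * r)%C <> 0%C.
Proof.
  intros Hz Hr E.
  assert (E1 : (zeta * r)%C = 1%C).
  { transitivity (1 - (1 - zeta * r))%C; [ring | rewrite E; ring]. }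
  apply (f_equal Cmod) in E1.
  rewrite Cmod_mult, Hz, Cmod_1, Cmod_R, Rabs_pos_eq in E1; lra.
Qed.

Lemma berezin_range_rotation (zeta : C) (hzeta : Cmod zeta = 1) (c : C) :
  berezin_range
    (composition_operator (rotation zeta hzeta) (rotation_preserves_hardy hzeta)) c
  <-> exists r : R, 0 <= r < 1 /\ c = (RtoC (1 - r) / (1 - zeta * r))%C.
Proof.
  assert (K : forall z : disk,
    (Cconj z * rotation zeta hzeta z)%C = (zeta * RtoC (Cmod z ^ 2))%C).
  { intros z; rewrite <- Cconj_mult_self.
    change (Cconj z * (zeta * z) = zeta * (Cconj z * z))%C; ring. }
  split.
  - intros [z ->]; exists (Cmod z ^ 2); rewrite berezin_composition, K.
    pose proof (Cmod_ge_0 z); pose proof (disk_lt1 z).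
    split; [simpl; nra | reflexivity].
  - intros [r [Hr ->]].
    assert (Hs : Cmod (RtoC (sqrt r)) < 1).
    { rewrite Cmod_R, Rabs_pos_eq by apply sqrt_pos.
      rewrite <- sqrt_1; apply sqrt_lt_1; lra. }
    exists (Disk Hs); rewrite berezin_composition, K; simpl disk_val.
    rewrite Cmod_R, Rabs_pos_eq, pow2_sqrt by (apply sqrt_pos || lra); reflexivity.
Qed.

Lemma unimodular_real (zeta : C) :
  Cmod zeta = 1 -> Im zeta = 0 -> zeta = RtoC 1 \/ zeta = RtoC (-1).
Proof.
  destruct zeta as [a b]; unfold Im; simpl; intros H ->.
  change (Cmod (RtoC a) = 1) in H; rewrite Cmod_R in H.
  unfold Rabs in H; destruct (Rcase_abs a).
  - right; unfold RtoC; f_equal; lra.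
  - left; unfold RtoC; f_equal; lra.
Qed.

(** The left-hand side is the midpoint of the curve points for parameters [0] and
    [1/2], whose values are [1] and [1 / (2 - zeta)]; it equals
    [(3 - zeta) / (2 (2 - zeta))].  Clearing denominators gives an
    equation linear in [r] whose coefficients all contain the factor [zeta - 1]. *)
Lemma midpoint_on_curve (zeta : C) (r : R) :
  Cmod zeta = 1 -> 0 <= r < 1 ->
  (RtoC (1 - 1 / 2) * (RtoC (1 - 0) / (1 - zeta * RtoC 0))
   + RtoC (1 / 2) * (RtoC (1 - 1 / 2) / (1 - zeta * RtoC (1 / 2))))%C
  = (RtoC (1 - r) / (1 - zeta * r))%C ->
  zeta = RtoC 1 \/ Im zeta = 0.
Proof.
  intros Hz Hr E.
  pose proof (one_minus_rotation_neq0 zeta r Hz Hr) as Dr.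
  assert (Dh : (1 - zeta * RtoC (1 / 2))%C <> 0%C)
    by (apply one_minus_rotation_neq0; [exact Hz | lra]).
  assert (H2 : RtoC 2 <> 0%C) by (intros H; apply RtoC_inj in H; lra).
  replace (1 - 1 / 2) with (/ 2) in E by lra.
  replace (1 / 2) with (/ 2) in E, Dh by lra.
  replace (1 - 0) with 1 in E by lra.
  rewrite RtoC_minus in E; rewrite RtoC_inv in E, Dh by lra.
  assert (D2 : (RtoC 2 - zeta)%C <> 0%C).
  { intros H; apply Dh.
    transitivity (/ RtoC 2 * (RtoC 2 - zeta))%C; [field; exact H2|].
    rewrite H; ring. }
  assert (F : ((zeta - 1) * (1 + r * (zeta - RtoC 4)))%C = 0%C).
  { set (m := ((3 - zeta) / (2 * (2 - zeta)))%C).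
    assert (M : m = ((1 - r) / (1 - zeta * r))%C).
    { rewrite <- E; unfold m; field; auto. }
    transitivity (2 * (2 - zeta) * (1 - zeta * r)
                  * (m - (1 - r) / (1 - zeta * r)))%C.
    - unfold m; field; auto.
    - rewrite M; ring. }
  destruct (Ceq_dec zeta 1) as [H1|H1]; [left; exact H1 | right].
  assert (G : (1 + r * (zeta - RtoC 4))%C = 0%C).
  { destruct (Ceq_dec (1 + r * (zeta - RtoC 4)) 0) as [G|G]; [exact G|].
    exfalso; revert F; apply Cmult_neq_0; [|exact G].
    intros H; apply H1; transitivity (zeta - 1 + 1)%C; [ring | rewrite H; ring]. }
  (* The imaginary part of [G] is [r * Im zeta = 0], and [r = 0] would turn [G]
     into [1 = 0]. *)
  destruct zeta as [a b]; unfold Im; simpl.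
  pose proof (f_equal fst G) as G1; pose proof (f_equal snd G) as G2.
  simpl in G1, G2.
  assert (r <> 0) by (intros ->; lra).
  apply (Rmult_eq_reg_l r); lra.
Qed.

Theorem theorem4p1 (zeta : C) (hzeta : Cmod zeta = 1) :
  convex_subset
    (berezin_range
      (composition_operator (rotation zeta hzeta)
                            (rotation_preserves_hardy hzeta)))
  <-> zeta = RtoC 1 \/ zeta = RtoC (-1).
Proof.
  split.
  - intros H.
    assert (B : forall r, 0 <= r < 1 -> berezin_range
      (composition_operator (rotation zeta hzeta) (rotation_preserves_hardy hzeta))
      (RtoC (1 - r) / (1 - zeta * r))%C).
    { intros r Hr; apply berezin_range_rotation; exists r; split; [exact Hr | reflexivity]. }
    specialize (H _ _ (1 / 2) (B 0 ltac:(lra)) (B (1 / 2) ltac:(lra)) ltac:(lra)).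
    apply berezin_range_rotation in H; destruct H as [r [Hr E]].
    destruct (midpoint_on_curve zeta r hzeta Hr E) as [H1|H1]; [left; exact H1|].
    apply unimodular_real; assumption.
  - intros Hz x y t Hx Hy Ht.
    apply berezin_range_rotation in Hx; destruct Hx as [r [Hr ->]].
    apply berezin_range_rotation in Hy; destruct Hy as [s [Hs ->]].
    apply berezin_range_rotation; destruct Hz as [-> | ->].
    + exists 0; split; [lra|].
      assert (P : forall q, q < 1 -> (RtoC (1 - q) / (1 - RtoC 1 * q))%C = RtoC 1).
      { intros q Hq; rewrite <- RtoC_mult, <- RtoC_minus, <- RtoC_div by lra.
        f_equal; field; lra. }
      rewrite !P, <- !RtoC_mult, <- RtoC_plus by lra; f_equal; ring.
    + (* The involution q |-> (1 - q) / (1 + q) exchanges the parameter interval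
         [0, 1) with the range (0, 1], so it also recovers the parameter. *)
      assert (P : forall q, 0 <= q ->
        (RtoC (1 - q) / (1 - RtoC (-1) * q))%C = RtoC ((1 - q) / (1 + q))).
      { intros q Hq; rewrite <- RtoC_mult, <- RtoC_minus, <- RtoC_div by lra.
        f_equal; field; lra. }
      assert (Q : forall q, 0 <= q < 1 -> 0 < (1 - q) / (1 + q) <= 1).
      { intros q Hq; split; [apply Rdiv_lt_0_compat; lra|].
        apply (Rmult_le_reg_r (1 + q)); [lra|].
        unfold Rdiv; rewrite Rmult_assoc, Rinv_l; lra. }
      rewrite !P, <- !RtoC_mult, <- RtoC_plus by lra.
      pose proof (Q r Hr) as Qr; pose proof (Q s Hs) as Qs.
      set (u := (1 - r) / (1 + r)) in *; set (v := (1 - s) / (1 + s)) in *.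
      set (w := (1 - t) * u + t * v).
      assert (Hw : 0 < w <= 1) by (unfold w; split; nra).
      exists ((1 - w) / (1 + w)).
      assert (Hq : 0 <= (1 - w) / (1 + w) < 1).
      { split; [apply Rdiv_le_0_compat; lra|].
        apply (Rmult_lt_reg_r (1 + w)); [lra|].
        unfold Rdiv; rewrite Rmult_assoc, Rinv_l; lra. }
      split; [exact Hq|].
      rewrite P by lra; f_equal; field; split; lra.
Qed.
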